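(* Let $X$ be a $\mathrm{CAT}(0)$ space with weak topology $\mathcal T_{\Delta}$. Every bounded $\mathcal T_{\Delta}$-closed subset $A$ of $X$ is $\mathcal T_{\Delta}$-compact.
   Context: All $\mathrm{CAT}(0)$ spaces are by definition complete and geodesic. A bounded sequence $(x_n)$ in a $\mathrm{CAT}(0)$ space $X$ converges weakly to a point $x\in X$ if for any compact geodesic $c$ in $X$ starting at $x$, the closest-point projections $\mathrm{Proj}_c(x_n)$ of $x_n$ to $c$ converge to $x$. The weak topology $\mathcal T_{\Delta}$ on $X$ is the topology whose closed sets are exactly those subsets $A\subset X$ such that whenever a bounded sequence of points of $A$ converges weakly to a point $x\in X$, one has $x\in A$. (It is the unique sequential topology on $X$ for which a sequence converges to $x$ if and only if it is bounded and converges weakly to $x$.) Compactness means that every net has a convergent subnet (equivalently, every open cover has a finite subcover); no Hausdorff property is included. *)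

(* Defs.v *)
From HB Require Import structures.
From mathcomp Require Import all_boot all_order all_algebra.
From mathcomp Require Import boolp classical_sets functions set_interval reals.
From mathcomp Require Import topology normedtype.

Set Implicit Arguments.
Unset Strict Implicit.
Unset Printing Implicit Defensive.

Import Order.TTheory GRing.Theory Num.Theory.
Import numFieldTopology.Exports.

Local Open Scope classical_set_scope.
Local Open Scope ring_scope.

Section MetricNotions.
Context {R : realType} {X : metricType R}.
Implicit Types (x y : X) (A C S : set X) (u : nat -> X).

Definition mbounded A :=
  exists M : R, forall x y, A x -> A y -> mdist x y <= M.

(* Compact geodesics parametrized by arc length on [0, L]; degenerate ones
   (L = 0) are allowed. *)
Definition geodesic (L : R) (c : R -> X) :=
  0 <= L /\
  forall s t, s \in `[0, L] -> t \in `[0, L] -> mdist (c s) (c t) = `|s - t|.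

Definition geodesic_segment x y S :=
  exists L c, [/\ geodesic L c, c 0 = x, c L = y & S = c @` `[0, L]].

Definition nearest_point C y p :=
  C p /\ forall q, C q -> mdist y p <= mdist y q.

(* The default value y is irrelevant in a CAT(0) space when C is a compact
   geodesic: the nearest point then exists and is unique. *)
Definition Proj C y : X := xget y (nearest_point C y).

Definition weak_cvg u x :=
  mbounded (range u) /\
  forall (L : R) (c : R -> X), geodesic L c -> c 0 = x ->
    Proj (c @` `[0, L]) (u n) @[n --> \oo] --> x.

Definition weak_closed A :=
  forall u x, (forall n, A (u n)) -> weak_cvg u x -> A x.

End MetricNotions.

(* The norm that the library puts on R * R is the sup norm. *)
Definition plane_dist {R : realType} (a b : R * R) : R :=
  Num.sqrt ((a.1 - b.1) ^+ 2 + (a.2 - b.2) ^+ 2).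

Section CAT0.
Context {R : realType} (X : metricType R).

Definition metric_complete :=
  forall u : nat -> X, cauchy (u @ \oo) -> exists x : X, u @ \oo --> x.

Definition geodesic_space :=
  forall x y : X, exists S, geodesic_segment x y S.

(* A geodesic triangle has vertices p i and sides S i from p i to p (i + 1),
   with i taken mod 3 (ordS is the cyclic successor). *)
Definition geodesic_triangle (p : 'I_3 -> X) (S : 'I_3 -> set X) :=
  forall i, geodesic_segment (p i) (p (ordS i)) (S i).

Definition comparison_triangle (p : 'I_3 -> X) (p' : 'I_3 -> R * R) :=
  forall i j, plane_dist (p' i) (p' j) = mdist (p i) (p j).

(* x' is the point of the Euclidean segment [p' i, p' (i + 1)] corresponding to
   a point x of the side S i; both distances together force x' to lie on that
   segment. *)
Definition comparison_point (p : 'I_3 -> X) (p' : 'I_3 -> R * R)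
    (i : 'I_3) (x : X) (x' : R * R) :=
  plane_dist (p' i) x' = mdist (p i) x /\
  plane_dist x' (p' (ordS i)) = mdist x (p (ordS i)).

Definition thin_triangles :=
  forall (p : 'I_3 -> X) (S : 'I_3 -> set X) (p' : 'I_3 -> R * R),
    geodesic_triangle p S -> comparison_triangle p p' ->
  forall (i j : 'I_3) (x y : X) (x' y' : R * R),
    S i x -> S j y ->
    comparison_point p p' i x x' -> comparison_point p p' j y y' ->
    mdist x y <= plane_dist x' y'.

Definition CAT0 := [/\ metric_complete, geodesic_space & thin_triangles].

End CAT0.

(* The carrier of X with the weak topology instead of the metric one. *)
Definition weak_space {R : realType} (X : metricType R) : Type := X.

Section WeakTopology.
Context {R : realType} (X : metricType R).

Lemma weak_cvg_reindex (u : nat -> X) (x : X) (g : nat -> nat) :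
  (forall n, (n <= g n)%N) -> weak_cvg u x -> weak_cvg (u \o g) x.
Proof.
move=> gn [[M uM] ux]; split.
  by exists M => _ _ [m _ <-] [n _ <-]; apply: uM; [exists (g m)|exists (g n)].
move=> L c cL c0.
have goo : g @ \oo --> \oo.
  by move=> P [N _ NP]; exists N => // n /= Nn; apply: NP; exact: leq_trans (gn n).
exact: (@cvg_comp _ _ _ g (fun n => Proj (c @` `[0, L]) (u n)) _ _ _ goo
  (ux L c cL c0)).
Qed.

Let weak_open (U : set X) := weak_closed (~` U).

Let weak_openT : weak_open setT.
Proof. by move=> u x /(_ 0%N) /= /(_ I). Qed.

Let weak_openI : setI_closed weak_open.
Proof.
move=> U V oU oV u x; rewrite setCI => uUV ux.
have [hU|] := pselect (forall N, exists n, (N <= n)%N /\ (~` U) (u n)).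
  have [g gP] := choice hU; left; apply: (oU (u \o g)) => [n|].
    by have [] := gP n.
  by apply: weak_cvg_reindex ux => n; have [] := gP n.
move=> /existsNP[N /forallNP hN]; right.
apply: (oV (fun n => u (n + N)%N)) => [n|].
  by have [Uu|//] := uUV (n + N)%N; have /not_andP[] := hN (n + N)%N;
    rewrite ?leq_addl.
by apply: (@weak_cvg_reindex u x (addn^~ N)) => // n; rewrite leq_addr.
Qed.

Let weak_open_bigcup (I : Type) (f : I -> set X) :
  (forall i, weak_open (f i)) -> weak_open (\bigcup_i f i).
Proof.
move=> of_ u x; rewrite setC_bigcup => uf ux i _.
by apply: (of_ i u x) => // n; exact: uf.
Qed.

HB.instance Definition _ := Choice.copy (weak_space X) X.
HB.instance Definition _ := isOpenTopological.Build (weak_space X)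
  weak_openT weak_openI weak_open_bigcup.

Lemma closed_weak_spaceE (A : set X) :
  closed (A : set (weak_space X)) <-> weak_closed A.
Proof.
suff opE : open (~` A : set (weak_space X)) = weak_closed A.
  by rewrite -opE; split => [/closed_openC//|/open_closedC]; rewrite setCK.
by rewrite [LHS]/(weak_closed (~` ~` A)) setCK.
Qed.

End WeakTopology.

(* Main.v *)
(** Let F be an ultrafilter containing A, put r(y) = lim_F d(y, -), and let x be
    a minimizer of r, which exists by the CN inequality and completeness.  Then
    F converges weakly to x, and this reduces to: every weakly closed C in F
    with C contained in A contains x.  Choose inductively a sequence (a_n) in C
    and a countable set Y containing x and all the a_n, closed under midpoints,
    such that d(y, a_n) tends to r(y) for every y in Y.  Replacing an arbitrary
    point p by an almost nearest point of Y does not increase the distances to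
    the a_n by much, so liminf d(p, a_n) >= r(x) for all p in X.  If the
    projections of the a_n to a geodesic c from x did not tend to x, Stewart's
    inequality would give a point p = c(b) violating this bound.  Hence a_n
    converges weakly to x and x lies in C. *)
Require Import Defs.
From mathcomp Require Import all_boot all_order all_algebra.
From mathcomp Require Import boolp classical_sets functions set_interval reals.
From mathcomp Require Import topology normedtype.
From mathcomp Require Import derive ring lra.

Set Implicit Arguments.
Unset Strict Implicit.
Unset Printing Implicit Defensive.

Import Order.TTheory GRing.Theory Num.Theory.
Import numFieldNormedType.Exports.

Local Open Scope classical_set_scope.
Local Open Scope ring_scope.

(** * Euclidean comparison, Stewart's inequality and midpoints *)

Lemma euclidean_triangle (R : realType) (a b c : R) :
  0 < a -> 0 <= b -> 0 <= c -> a <= b + c -> b <= a + c -> c <= a + b ->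
  exists u v : R, u ^+ 2 + v ^+ 2 = b ^+ 2 /\ (u - a) ^+ 2 + v ^+ 2 = c ^+ 2.
Proof.
move=> a0 b0 c0 abc bac cab.
(* The law of cosines gives the abscissa of the apex over the base from [(0, 0)] to [(a, 0)]; the
   triangle inequalities bound it by [b] in absolute value, so the height is real. *)
pose u := (a ^+ 2 + b ^+ 2 - c ^+ 2) / (2 * a).
have ua : u * (2 * a) = a ^+ 2 + b ^+ 2 - c ^+ 2 by rewrite /u; field; lra.
have ub : u <= b by rewrite ler_pdivrMr; nra.
have bu : - b <= u by rewrite ler_pdivlMr; nra.
have v0 : 0 <= b ^+ 2 - u ^+ 2 by nra.
exists u, (Num.sqrt (b ^+ 2 - u ^+ 2)); rewrite sqr_sqrtr//; split; first ring.
by rewrite [RHS](_ : _ = a ^+ 2 + b ^+ 2 - u * (2 * a)); [ring|rewrite ua; ring].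
Qed.

Lemma plane_dist_eq (R : realType) (a b : R * R) (d : R) : 0 <= d ->
  (a.1 - b.1) ^+ 2 + (a.2 - b.2) ^+ 2 = d ^+ 2 -> plane_dist a b = d.
Proof. by move=> d0 e; rewrite /plane_dist e sqrtr_sqr ger0_norm. Qed.

Section CAT0Geometry.
Context {R : realType} (X : metricType R).
Implicit Types (w x y z m p q : X) (C : set X).
Notation d := (@mdist R X).

Definition is_mid m y z := d y m = d y z / 2 /\ d m z = d y z / 2.

Hypothesis thinX : thin_triangles X.
Hypothesis geoX : geodesic_space X.

(** For [L > 0], thinness compares the vertex [w] with a point of the opposite side; in the plane
    the right-hand side is exactly the squared distance, by Stewart's theorem. *)
Lemma stewart_segment (L s : R) (c : R -> X) w : geodesic L c ->
  0 <= s <= 1 ->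
  d w (c (s * L)) ^+ 2 <= (1 - s) * d w (c 0) ^+ 2 + s * d w (c L) ^+ 2
                          - s * (1 - s) * L ^+ 2.
Proof.
move=> cL s01; have [L0 cE] := cL.
have [/eqP L_eq0|L_neq0] := boolP (L == 0); first by rewrite L_eq0 mulr0; lra.
have {L_neq0} Lgt0 : 0 < L by rewrite lt_def L_neq0.
have in0 : 0 \in `[0, L]%R by rewrite in_itv/= lexx.
have inL : L \in `[0, L]%R by rewrite in_itv/= lexx L0.
have ins : s * L \in `[0, L]%R by rewrite in_itv/=; nra.
have yz : d (c 0) (c L) = L by rewrite cE// sub0r normrN ger0_norm.
have yw := metric_sym (c 0) w.
have zw := metric_sym (c L) w.
have ym : d (c 0) (c (s * L)) = s * L.
  by rewrite cE// sub0r normrN ger0_norm//; nra.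
have mz : d (c (s * L)) (c L) = (1 - s) * L.
  by rewrite cE// distrC ger0_norm; [ring|nra].
have [u [v [uvb uvc]]] : exists u v : R, u ^+ 2 + v ^+ 2 = d w (c 0) ^+ 2 /\
    (u - L) ^+ 2 + v ^+ 2 = d w (c L) ^+ 2.
  apply: euclidean_triangle; rewrite ?mdist_ge0//.
  - by have := metric_triangle (c 0) w (c L); lra.
  - by have := metric_triangle w (c L) (c 0); rewrite (metric_sym (c L) (c 0)); lra.
  - by have := metric_triangle w (c 0) (c L); lra.
pose p (i : 'I_3) := nth (c 0) [:: c 0; c L; w] i.
pose p' (i : 'I_3) := nth (0, 0) [:: (0, 0); (L, 0); (u, v)] i.
have [S0 S0P] := choice (fun i : 'I_3 => geoX (p i) (p (ordS i))).
(* The first side has to be the given [c], so that it contains [c (s * L)]; the other two are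
   arbitrary. *)
pose S (i : 'I_3) := if i == ord0 then c @` `[0, L] else S0 i.
have pS : geodesic_triangle p S.
  move=> i; rewrite /S; case: eqP => [->|_]; last exact: S0P.
  by exists L, c.
have pp' : comparison_triangle p p'.
  move=> [[|[|[|//]]] i3] [[|[|[|//]]] j3]; apply: plane_dist_eq;
    rewrite ?mdist_ge0// /p /p'/= ?mdistxx ?yw ?zw ?(metric_sym (c L) (c 0)) ?yz -?uvb -?uvc; ring.
have i2 : (2 < 3)%N by [].
have cm : comparison_point p p' ord0 (c (s * L)) (s * L, 0).
  split; apply: plane_dist_eq; rewrite ?mdist_ge0// /p /p'/= ?ym ?mz; ring.
have cw : comparison_point p p' (Ordinal i2) w (u, v).
  split; apply: plane_dist_eq; rewrite ?mdist_ge0// /p /p'/= ?mdistxx -?uvb; ring.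
have Sm : S ord0 (c (s * L)) by exists (s * L).
have Sw : S (Ordinal i2) w.
  have [L' [c' [[L'0 _] c'0 _ ->]]] := pS (Ordinal i2); exists 0 => //=.
  by rewrite in_itv/= lexx.
have := thinX pS pp' Sw Sm cw cm; rewrite /plane_dist/= => wm.
rewrite (le_trans (lerXn2r 2 _ _ wm)) ?nnegrE ?mdist_ge0 ?sqrtr_ge0//.
rewrite sqr_sqrtr ?addr_ge0 ?sqr_ge0// -uvb -uvc le_eqVlt; apply/orP; left.
by apply/eqP; ring.
Qed.

Lemma stewart (s : R) w y z m : 0 <= s <= 1 ->
  d y m = s * d y z -> d m z = (1 - s) * d y z ->
  d w m ^+ 2 <= (1 - s) * d w y ^+ 2 + s * d w z ^+ 2 - s * (1 - s) * d y z ^+ 2.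
Proof.
move=> s01 ym mz; have [_ [L [c [cL c0 cLz _]]]] := geoX y z.
have yz : d y z = L.
  have [L0 cE] := cL; rewrite -c0 -cLz cE ?sub0r ?normrN ?ger0_norm//.
    by rewrite in_itv/= lexx.
  by rewrite in_itv/= L0 lexx.
have stL v : _ := stewart_segment v cL s01.
(* Applied to w = m, the inequality identifies m with the point of c. *)
have /mdist_positivity -> : d m (c (s * L)) = 0.
  apply/eqP; rewrite -sqrf_eq0 eq_le sqr_ge0 andbT (le_trans (stL m))//.
  rewrite c0 cLz (metric_sym m y) ym mz yz le_eqVlt; apply/orP; left.
  by apply/eqP; ring.
by rewrite (le_trans (stL w))// c0 cLz yz.
Qed.

(** This is the CN inequality of Bruhat and Tits. *)
Lemma is_mid_le w y z m : is_mid m y z ->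
  d w m ^+ 2 <= d w y ^+ 2 / 2 + d w z ^+ 2 / 2 - d y z ^+ 2 / 4.
Proof.
move=> [ym mz]; rewrite (le_trans (@stewart (1 / 2) w y z m _ _ _)); lra.
Qed.

Lemma ex_mid y z : exists m, is_mid m y z.
Proof.
have [_ [L [c [[L0 cE] c0 cLz _]]]] := geoX y z.
have yz : d y z = L.
  by rewrite -c0 -cLz cE ?sub0r ?normrN ?ger0_norm// in_itv/= lexx ?L0.
have ins : L / 2 \in `[0, L]%R by rewrite in_itv/=; lra.
exists (c (L / 2)); rewrite /is_mid yz -{1}c0 -cLz !cE// ?in_itv/= ?lexx ?L0//.
by rewrite sub0r normrN distrC !ger0_norm//; lra.
Qed.

(* Halving [q, z] k times towards q and applying the CN inequality each time
   approaches the projection inequality, for which C need not be complete. *)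
Lemma near_proj (k : nat) C (e : R) p q :
  (forall y z, C y -> C z -> exists2 m, C m & is_mid m y z) ->
  C q -> (forall z, C z -> d p q ^+ 2 <= d p z ^+ 2 + e) ->
  forall z, C z ->
    (1 - 2^-1 ^+ k) * d q z ^+ 2 <= d p z ^+ 2 - d p q ^+ 2 + 2 ^+ k * e.
Proof.
move=> Cmid Cq qP; elim: k => [|k IH] z Cz.
  by have := qP _ Cz; rewrite !expr0; lra.
have [m Cm qzm] := Cmid _ _ Cq Cz.
have := is_mid_le p qzm; have := IH _ Cm; have [-> _] := qzm.
rewrite !exprS; set t := 2^-1 ^+ k; set T := 2 ^+ k; lra.
Qed.

End CAT0Geometry.

(** * Ultrafilter limits, minimizers and realizing sequences *)

Lemma ultra_cvg (T : Type) (R : realType) (F : set_system T) (f : T -> R) (M : R) :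
  UltraFilter F -> F [set t | 0 <= f t <= M] -> exists l : R, f @ F --> l.
Proof.
move=> FU FM.
(* Compactness supplies a cluster point, and an ultrafilter converges to each of its cluster
   points. *)
have [l [_ fl]] : `[0, M]%classic `&` cluster (fmap f F) !=set0.
  apply: (@segment_compact _ 0 M (fmap f F)).
  have : F (f @^-1` `[0, M]) by apply: filterS FM => t /= fM; rewrite in_itv.
  by [].
exists l => B lB; have [//|FB] := in_ultra_setVsetC (f @^-1` B) FU.
by have [t []] := fl (~` B) B FB lB.
Qed.

Section Minimizer.
Context {R : realType} (X : metricType R).
Implicit Types (w x y z m p q : X) (C : set X).
Notation d := (@mdist R X).

Lemma near_inf (T : Type) (f : T -> R) (C : set T) (e : R) : 0 < e ->
  C !=set0 -> (forall t, 0 <= f t) ->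
  exists2 t, C t & forall t', C t' -> f t <= f t' + e.
Proof.
move=> e0 [t Ct] f0.
have lbf : has_lbound (f @` C) by exists 0 => _ [t' _ <-].
have [_ [t' Ct' <-] t'P] := inf_adherent e0 (conj (ex_intro _ _ (imageP f Ct)) lbf).
exists t' => // t'' Ct''; rewrite (le_trans (ltW t'P))// lerD2r.
by apply: ge_inf => //; exact: imageP.
Qed.

(** At the point [m] attached to two almost minimizers, [r] cannot be much smaller, so the quadratic
    inequality makes a minimizing sequence Cauchy. *)
Lemma ex_minimizer (r : X -> R) : metric_complete X -> [set: X] !=set0 ->
  (forall y, 0 <= r y) -> (forall y z, r y <= r z + d y z) ->
  (forall y z, exists m, r m ^+ 2 <= r y ^+ 2 / 2 + r z ^+ 2 / 2 - d y z ^+ 2 / 4) ->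
  exists x, forall y, r x <= r y.
Proof.
move=> complX X0 r0 rlip rmid.
have e0 n : 0 < n.+1%:R^-1 :> R by rewrite invr_gt0.
have /choice [y yP] n : exists y, forall z, r y <= r z + n.+1%:R^-1.
  by have [y _ yP] := near_inf (e0 n) X0 r0; exists y => z; exact: yP.
(* With [b = 1 / (N + 1)], both values of [r] are at most [r m + b], so the squared distance is at
   most [4 * (2 * r m + b) * b]; now use [r m <= r (y 0) + 1] and [b <= 1]. *)
have yd N n : (N <= n)%N -> d (y N) (y n) ^+ 2 <= 4 * (2 * r (y 0%N) + 3) * N.+1%:R^-1.
  move=> Nn; have [m] := rmid (y N) (y n).
  have := yP n m; have := yP N m; have := yP n (y 0%N); have := yP N (y 0%N).
  have : n.+1%:R^-1 <= N.+1%:R^-1 :> R by rewrite lef_pV2 ?posrE ?ler_nat.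
  have : N.+1%:R^-1 <= 1 :> R by rewrite invf_le1 ?ler1n.
  move: (e0 n) (e0 N) (r0 m) (r0 (y n)) (r0 (y N)) (r0 (y 0%N)).
  move: (n.+1%:R^-1) (N.+1%:R^-1) => a b.
  move=> a0 b0 rm rn rN r00 b1 ab rN0 rn0 rNm rnm.
  have sq_le (u v : R) : 0 <= u -> u <= v -> u ^+ 2 <= v ^+ 2.
    by move=> u0 uv; rewrite lerXn2r ?nnegrE//; lra.
  have : r (y n) ^+ 2 <= (r m + b) ^+ 2 by apply: sq_le; lra.
  have : r (y N) ^+ 2 <= (r m + b) ^+ 2 by apply: sq_le; lra.
  have : r (y n) ^+ 2 <= (r (y 0%N) + 1) ^+ 2 by apply: sq_le; lra.
  have : r (y N) ^+ 2 <= (r (y 0%N) + 1) ^+ 2 by apply: sq_le; lra.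
  have := sqr_ge0 (d (y N) (y n)); move: (d _ _ ^+ 2) => D.
  move=> D0 hN0 hn0 hN hn hm.
  have m_le : r m <= r (y 0%N) + 1.
    by rewrite -(ler_pXn2r (n := 2)) ?nnegrE//; lra.
  have : (2 * r m + b) * b <= (2 * r (y 0%N) + 3) * b by rewrite ler_wpM2r; lra.
  lra.
have /complX[x yx] : cauchy (y @ \oo).
  apply: cauchy_exP => e egt0; pose K := 4 * (2 * r (y 0%N) + 3).
  have [N NP] : exists N : nat, K / e ^+ 2 < N.+1%:R.
    exists (Num.truncn (K / e ^+ 2)); apply: truncnS_gt.
  exists (y N), N => // n /= Nn; rewrite ballEmdist/=.
  rewrite -(ltr_pXn2r (n := 2))// ?nnegrE ?mdist_ge0 ?(ltW egt0)//.
  apply: le_lt_trans (yd _ _ Nn) _; rewrite -/K ltr_pdivrMr// mulrC.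
  by rewrite -ltr_pdivrMr// exprn_gt0.
exists x => z; suff xz (e : R) : 0 < e -> r x <= r z + e by apply/ler_addgt0Pr; exact: xz.
move=> egt0.
have [N _ NP] : \forall n \near \oo, ball x (e / 2) (y n).
  by move/cvg_ballP : yx; apply; rewrite divr_gt0.
pose n := maxn N (Num.truncn (2 / e)).
have := NP n (leq_maxl _ _); rewrite ballEmdist/= => xn.
have en : n.+1%:R^-1 <= e / 2.
  rewrite -[e / 2]invrK lef_pV2 ?posrE// ?invr_gt0 ?divr_gt0// invf_div.
  by rewrite (le_trans (ltW (truncnS_gt _)))// ler_nat ltnS leq_maxr.
have yz := yP n z; have xy := rlip x (y n).
rewrite (le_trans xy)// (splitr e) addrA lerD ?(ltW xn)//.
by rewrite (le_trans yz)// lerD2l.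
Qed.

(** A filter is closed only under finite intersections, so stage [n] matches the distances from a
    finite list, up to [1 / (n + 1)]; a point of [Y] stays in all lists once it has entered one. *)
Lemma ex_realizing_seq (F : set_system X) (r : X -> R) C x :
  ProperFilter F -> F C -> geodesic_space X ->
  (forall y, d y @ F --> r y) ->
  exists (a : nat -> X) (Y : set X), [/\ forall n, C (a n), Y x,
    forall n, Y (a n),
    forall y z, Y y -> Y z -> exists2 m, Y m & is_mid m y z &
    forall y, Y y -> d y (a n) @[n --> \oo] --> r y].
Proof.
move=> FF FC geoX rP.
have /choice [mid midP] (yz : X * X) := ex_mid geoX yz.1 yz.2.
have /choice [a aP] (sn : seq X * nat) : exists b, C b /\
    forall y, y \in sn.1 -> `|r y - d y b| < sn.2.+1%:R^-1.
  case: sn => s n /=; apply: (@filter_ex _ F).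
  elim: s => [|y s IH]; first by apply: filterS FC.
  have ry : \forall b \near F, `|r y - d y b| < n.+1%:R^-1.
    by move/cvgrPdist_lt : (rP y); apply; rewrite invr_gt0.
  apply: filterS2 IH ry => b [Cb sb] yb; split=> // z.
  by rewrite in_cons => /orP[/eqP->//|]; exact: sb.
(* Each stage adds the point just chosen and the midpoints of all listed pairs. *)
pose s := fix s n : seq X := if n is k.+1 then
  a (s k, k) :: s k ++ [seq mid (y, z) | y <- s k, z <- s k] else [:: x].
have s_mono n k y : (n <= k)%N -> y \in s n -> y \in s k.
  move=> /subnKC <-; elim: (k - n)%N => [|j IH yn]; first by rewrite addn0.
  by rewrite addnS /= in_cons mem_cat IH ?orbT.
exists (fun n => a (s n, n)), [set y | exists n, y \in s n]; split.
- by move=> n; have [] := aP (s n, n).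
- by exists 0%N; rewrite inE.
- by move=> n; exists n.+1; rewrite /= in_cons eqxx.
- move=> y z [n yn] [k zk]; exists (mid (y, z)); last exact: (midP (y, z)).
  exists (maxn n k).+1; rewrite /= in_cons mem_cat allpairs_f ?orbT//.
    by apply: s_mono yn; exact: leq_maxl.
  by apply: s_mono zk; exact: leq_maxr.
- move=> y [N yN]; apply/cvgrPdist_lt => e e0.
  exists (maxn N (Num.truncn e^-1)) => // n /=; rewrite geq_max => /andP[Nn en].
  have [_ /(_ y (s_mono _ _ _ Nn yN))/= yan] := aP (s n, n).
  rewrite (lt_le_trans yan)// -[leRHS]invrK lef_pV2 ?posrE ?invr_gt0//.
  by rewrite (le_trans (ltW (truncnS_gt _)))// ler_nat ltnS.
Qed.

End Minimizer.

(** * Lower bounds on distances and weak convergence *)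

Section WeakLimits.
Context {R : realType} (X : metricType R).
Implicit Types (w x y z m p q : X) (C : set X).
Notation d := (@mdist R X).

(** By [near_proj] at an almost nearest point [q] of [Y], [d p (a n)] is not much smaller than
    [d q (a n)], which tends to [r q >= r x]. *)
Lemma dist_liminf (a : nat -> X) (Y : set X) (r : X -> R) x p (e : R) :
  thin_triangles X -> geodesic_space X ->
  (forall n, Y (a n)) ->
  (forall y z, Y y -> Y z -> exists2 m, Y m & is_mid m y z) ->
  (forall y, Y y -> d y (a n) @[n --> \oo] --> r y) ->
  0 <= r x -> (forall y, r x <= r y) -> 0 < e ->
  \forall n \near \oo, r x ^+ 2 - e <= d p (a n) ^+ 2.
Proof.
move=> thinX geoX Ya Ymid Yr rx0 rmin e0.
(* Three errors of at most [h] add up: the factor [1 - 2^-1 ^+ k] on [r x ^+ 2], the convergence of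
   [d q (a n) ^+ 2], and the slack [h * 2^-1 ^+ k] of [q] magnified by [2 ^+ k]. *)
pose h := e / 3; have h0 : 0 < h by rewrite divr_gt0.
pose k := Num.truncn (r x ^+ 2 / h).
have tk0 : 0 < 2^-1 ^+ k :> R by rewrite exprn_gt0// invr_gt0.
have tk : 2^-1 ^+ k * r x ^+ 2 <= h.
  rewrite exprVn mulrC ler_pdivrMr ?exprn_gt0// mulrC -ler_pdivrMr//.
  by rewrite (le_trans (ltW (truncnS_gt _)))// -natrX ler_nat ltn_expl.
have [q Yq qP] : exists2 q, Y q &
    forall z, Y z -> d p q ^+ 2 <= d p z ^+ 2 + h * 2^-1 ^+ k.
  apply: (@near_inf _ _ (fun z => d p z ^+ 2)) => [||z]; last exact: sqr_ge0.
    by rewrite mulr_gt0.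
  by exists (a 0%N).
have qr : d q (a n) * d q (a n) @[n --> \oo] --> r q * r q.
  by apply: cvgM; exact: Yr.
have /cvgrPdist_lt/(_ _ h0) := qr; apply: filterS => n.
rewrite ltr_norml => /andP[_ qan].
have := near_proj thinX geoX k Ymid Yq qP (Ya n).
have -> : 2 ^+ k * (h * 2^-1 ^+ k) = h.
  by rewrite exprVn mulrC -mulrA mulVf ?mulr1 ?expf_neq0 ?pnatr_eq0.
have t1 : 2^-1 ^+ k <= 1 :> R by rewrite exprVn invf_le1 ?exprn_ege1 ?exprn_gt0// ler1n.
have rxq : r x ^+ 2 <= r q ^+ 2 by rewrite lerXn2r ?nnegrE// (le_trans rx0).
move: tk0 tk qan t1 rxq; rewrite -!expr2 (_ : e = 3 * h) => [|]; last by rewrite /h; field.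
have := sqr_ge0 (d p q).
move: (2^-1 ^+ k) (d q _ ^+ 2) (d p q ^+ 2) (d p _ ^+ 2) (r x ^+ 2) (r q ^+ 2) (sqr_ge0 (r x)).
move=> t D Q P rx rq rx20 Q0 t0 trx Drq t1 rxq near.
have : (1 - t) * (rx - h) <= (1 - t) * D by rewrite ler_wpM2l; lra.
have : 0 <= t * h by rewrite mulr_ge0; lra.
lra.
Qed.

(** The distance to [y] is continuous along [c] and attains its minimum, so [xget] returns a nearest
    point and not its default. *)
Lemma Proj_geodesic (L : R) (c : R -> X) y : geodesic L c ->
  exists2 t, t \in `[0, L]%R & Proj (c @` `[0, L]) y = c t /\
    forall s, s \in `[0, L]%R -> d y (c t) <= d y (c s).
Proof.
move=> [L0 cE].
have cont : {within `[0, L], continuous (fun s => d y (c s))}.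
  apply/subspace_continuousP => s s0L; apply/cvgrPdist_lt => e e0.
  rewrite near_withinE; exists e => // t /= st t0L; apply: le_lt_trans st.
  have := metric_triangle y (c s) (c t); have := metric_triangle y (c t) (c s).
  rewrite (metric_sym (c t)) (cE s t)// => h1 h2.
  rewrite /from_subspace ler_norml; apply/andP; split; lra.
have [t t0L tmin] := EVT_min L0 cont.
have ex : exists p, nearest_point (c @` `[0, L]) y p.
  by exists (c t); split; [exists t|move=> _ [s /= s0L <-]; exact: tmin].
have [[t' t'0L t'E] t'min] := xgetPex y ex.
exists t' => //; split; first by rewrite t'E.
by move=> s s0L; rewrite t'E; apply: t'min; exists s.
Qed.

Lemma weak_cvg_minimizer (a : nat -> X) (l : R) x :
  thin_triangles X -> geodesic_space X -> mbounded (range a) -> 0 <= l ->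
  d x (a n) @[n --> \oo] --> l ->
  (forall p e, 0 < e -> \forall n \near \oo, l ^+ 2 - e <= d p (a n) ^+ 2) ->
  weak_cvg a x.
Proof.
move=> thinX geoX ba l0 xa liminf; split=> // L c cL c0.
apply/cvg_ballP => e e0.
(* If d(x, c t) >= e = 2 b, then d(a n, c b)^2 <= d(a n, x)^2 - b^2. *)
pose b := e / 2; have b0 : 0 < b by rewrite divr_gt0.
(* This tolerance is spent twice, on the lower bound at [c b] and on the limit at [x]; the total
   stays below the gain [b ^+ 2]. *)
have b20 : 0 < b ^+ 2 / 3 by rewrite divr_gt0 ?exprn_gt0.
have xa2 : d x (a n) * d x (a n) @[n --> \oo] --> l * l by exact: cvgM.
have /cvgrPdist_lt/(_ _ b20) := xa2.
apply: filterS2 (liminf (c b) _ b20) => n.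
rewrite ltr_norml => cba /andP[xan _].
have [t t0L [-> tmin]] := Proj_geodesic (a n) cL.
rewrite ballEmdist/= ltNge; apply/negP => ext.
have [L0 cE] := cL.
have in0 : 0 \in `[0, L]%R by rewrite in_itv/= lexx.
have /andP[t0 tL] : 0 <= t <= L by move: t0L; rewrite in_itv.
have xt : d x (c t) = t by rewrite -c0 cE// sub0r normrN ger0_norm.
have bt : 2 * b <= t by rewrite -xt /b; lra.
have inb : b \in `[0, L]%R by rewrite in_itv/=; lra.
have xb : d x (c b) = b by rewrite -c0 cE// sub0r normrN ger0_norm// ltW.
have tgt0 : 0 < t by lra.
have btt : b / t * t = b by rewrite divfK// gt_eqF.
have bt0 : 0 <= b / t by rewrite divr_ge0// ltW.
have bt1 : b / t <= 1 by rewrite ler_pdivrMr//; lra.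
have : d (a n) (c b) ^+ 2 <= (1 - b / t) * d (a n) x ^+ 2 +
    b / t * d (a n) (c t) ^+ 2 - b / t * (1 - b / t) * d x (c t) ^+ 2.
  apply: stewart => //; rewrite ?bt0// xt.
    by rewrite xb btt.
  by rewrite mulrBl btt mul1r cE// distrC ger0_norm//; lra.
have tx : d (a n) (c t) ^+ 2 <= d (a n) x ^+ 2.
  by rewrite lerXn2r ?nnegrE ?mdist_ge0// -c0 tmin.
have : b / t * d (a n) (c t) ^+ 2 <= b / t * d (a n) x ^+ 2 by rewrite ler_wpM2l.
(* The subtracted term is [b * (t - b)], at least [b ^+ 2] since [2 * b <= t]. *)
rewrite xt (_ : b / t * (1 - b / t) * t ^+ 2 = b / t * t * (t - b / t * t)); last by ring.
rewrite btt; have : b * b <= b * (t - b) by rewrite ler_pM2l//; lra.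
move: cba xan; rewrite (metric_sym (c b)) (metric_sym x) -!expr2.
move: b20; rewrite expr2; lra.
Qed.

End WeakLimits.

(** * Compactness through ultrafilters *)

Theorem corollary5p3 (R : realType) (X : metricType R) (hX : CAT0 X)
  (A : set (weak_space X)) (hbounded : @mbounded R X A) (hclosed : closed A) :
  compact A.
Proof.
have [complX geoX thinX] := hX; have [M AM] := hbounded.
rewrite compact_ultra => F FU FA.
have /choice [r rP] (y : X) : exists l : R, (fun b : X => mdist y b) @ F --> l.
  have [b Ab] := filter_ex FA.
  apply: (@ultra_cvg _ _ _ _ (mdist y b + M)); apply: filterS FA => t At /=.
  rewrite mdist_ge0 (le_trans (metric_triangle y b t))// lerD2l; exact: AM.
have r0 y : 0 <= r y.
  by apply: cvgr_to_ge (rP y) _; apply: nearW => b; exact: mdist_ge0.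
have rlip y z : r y <= r z + mdist y z.
  apply: ler_cvg_to (rP y) (cvgD (rP z) (cvg_cst (mdist y z))) _.
  by apply: nearW => b /=; rewrite addrC; exact: metric_triangle.
have rmid y z : exists m,
    r m ^+ 2 <= r y ^+ 2 / 2 + r z ^+ 2 / 2 - mdist y z ^+ 2 / 4.
  have [m yzm] := ex_mid geoX y z; exists m.
  have r2 w : mdist w b ^+ 2 @[b --> F] --> r w ^+ 2.
    by rewrite expr2; under eq_cvg do rewrite expr2; exact: cvgM.
  apply: ler_cvg_to (r2 m) (cvgB (cvgD (cvgMl (r2 y)) (cvgMl (r2 z))) (cvg_cst _)) _.
  apply: nearW => b /=; have := is_mid_le thinX geoX b yzm.
  by rewrite !(metric_sym b).
have [b0 _] := filter_ex FA.
have [x xmin] := ex_minimizer complX (ex_intro _ b0 I) r0 rlip rmid.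
have xin (C : set X) : C `<=` A -> weak_closed C -> F C -> C x.
  move=> CA wC FC.
  have [a [Y [Ca Yx Ya Ymid Yr]]] := ex_realizing_seq x _ FC geoX rP.
  apply: (wC a x Ca); apply: (@weak_cvg_minimizer _ _ _ (r x)) => //.
  - by exists M => _ _ [n _ <-] [k _ <-]; apply: AM; apply: CA.
  - exact: Yr.
  - by move=> p e e0; apply: dist_liminf Ymid Yr _ _ e0.
exists x; split; first by apply: xin => //; apply/closed_weak_spaceE.
(* If the weakly open [O] were not in [F], its complement would be, and [xin] applied to the part of
   [A] outside [O] would put [x] outside [O]. *)
move=> U; rewrite nbhsE => -[O [oO Ox] OU]; apply: filterS OU _.
have [//|FO] := in_ultra_setVsetC O FU.
suff [_ /(_ Ox)] : (A `&` ~` O) x by [].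
apply: xin; first exact: subIsetl.
  by apply/closed_weak_spaceE; apply: closedI => //; exact: open_closedC.
exact: filterI.
Qed.
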